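(* For any fixed constant $r$, the $r$-dimensional simplex enumeration problem can be solved in $O(n^{r-2+1/(r+1)}/\log n)$ rounds in the CLIQUE model for $r$-uniform hypergraphs on $n$ vertices.
   Context: A hypergraph $H=(V,E)$ has vertex set $V$, $|V|=n$, and a set $E$ of nonempty subsets of $V$; it is $r$-uniform if every edge has exactly $r$ vertices. An $r$-dimensional simplex in an $r$-uniform hypergraph is a set $S=\{v_0,\dots,v_r\}$ of $r+1$ vertices all of whose $r$-element subsets are edges. In the simplex enumeration problem each vertex $v$ must output a set $\mathcal S_v$ of simplices such that the $\mathcal S_v$ are pairwise disjoint and $\bigcup_v \mathcal S_v$ is the set of all simplices of $H$. CLIQUE model: vertices are computing nodes with unique $O(\log n)$-bit IDs; computation proceeds in synchronous rounds with unbounded local computation; in each round each vertex may send a distinct $B$-bit message, $B=\Theta(\log n)$, to every other vertex of $V$. Initially each vertex knows its own ID, and its incident edges, including the IDs of all vertices in them ($\mathrm{KT}_1$).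
   Formalization: The constant r is assumed to be at least 2; for r = 1 the stated bound tends to 0, so zero rounds would have to suffice for large n, which is impossible since a vertex cannot know the other vertices' edges. *)

(* Defs.v *)
From mathcomp Require Import all_boot.

Set Implicit Arguments.
Unset Strict Implicit.
Unset Printing Implicit Defensive.

Record hypergraph (V : finType) := Hypergraph {
  edges : {set {set V}};
  edges_nonempty : set0 \notin edges
}.

Section Simplices.
Variables (V : finType) (H : hypergraph V).

Definition uniform (r : nat) : Prop :=
  forall e : {set V}, e \in edges H -> #|e| = r.

Definition incident_edges (v : V) : {set {set V}} :=
  [set e in edges H | v \in e].

Definition simplices (r : nat) : {set {set V}} :=
  [set S : {set V} | (#|S| == r.+1) &&
     [forall e : {set V}, (e \subset S) && (#|e| == r) ==> (e \in edges H)]].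

Definition enumerates_simplices (r : nat) (S_ : V -> {set {set V}}) : Prop :=
  (forall u v : V, u != v -> [disjoint S_ u & S_ v]) /\
  \bigcup_(v : V) S_ v = simplices r.

End Simplices.

Definition ident (l : nat) := l.-tuple bool.
Definition message (b : nat) := b.-tuple bool.

(* Deterministic CLIQUE algorithm with l-bit IDs and b-bit messages. The same
   functions, otherwise arbitrary (local computation is unbounded), are run by
   every vertex. A vertex addresses its messages by the ID of the recipient, and
   messages addressed to an ID that no vertex bears are lost; None stands for
   "no message". *)
Record algorithm (l b : nat) := Algorithm {
  state : Type;
  (* own ID, and incident edges as sets of IDs *)
  start : ident l -> {set {set ident l}} -> state;
  send : state -> ident l -> option (message b);
  (* current state, and the message received from each ID in this round *)
  receive : state -> (ident l -> option (message b)) -> state;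
  output : state -> {set {set ident l}}
}.

Section Execution.
Variables (l b : nat) (A : algorithm l b).
Variables (V : finType) (H : hypergraph V) (id_of : V -> ident l).

Definition initial (v : V) : state A :=
  start A (id_of v) [set id_of @: e | e : {set V} in incident_edges H v].

Definition inbox (conf : V -> state A) (v : V) (i : ident l) :
    option (message b) :=
  if [pick u : V | (u != v) && (id_of u == i)] is Some u
  then send (conf u) (id_of v) else None.

Definition round (conf : V -> state A) (v : V) : state A :=
  receive (conf v) (inbox conf v).

Definition run (T : nat) : V -> state A := iter T round initial.

End Execution.

(* The vertices output simplices as sets of IDs. *)
Definition solves_simplex_enumeration (r n l b : nat) (A : algorithm l b)
    (T : nat) : Prop :=
  forall (V : finType) (H : hypergraph V) (id_of : V -> ident l),
    #|V| = n -> uniform H r -> injective id_of ->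
  exists S_ : V -> {set {set V}},
    enumerates_simplices H r S_ /\
    forall v : V,
      output (run A H id_of T v) = [set id_of @: S | S : {set V} in S_ v].

(* Main.v *)
(* Let q be the integer part of n^(1/(r+1)) and split the vertices into q groups
   of about n/q. Assign every (r+1)-tuple of groups to a worker vertex, which
   must learn all edges inside its r+1 groups: about (n/q)^r potential edges,
   i.e. n^(r-1+1/(r+1)) bits, one bit per potential edge. These bits are known
   to few vertices, so they are routed in two hops: the owner of a potential
   edge tells its relay whether the edge is present, and the relay tells the
   workers. Who must send which potential edge to whom depends only on the set
   of IDs, so no addressing is needed, and the relays are chosen so that no
   ordered pair of vertices has to exchange more than O(q n^(r-2)) bits. Sending
   these bits B at a time gives the bound. *)
Require Import Defs.
From mathcomp Require Import all_boot.
From mathcomp Require Import ring.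
From mathcomp Require boolp.

Set Implicit Arguments.
Unset Strict Implicit.
Unset Printing Implicit Defensive.

(** * Splitting long messages into short ones *)

Section Chunks.
Variables (l b k c : nat).
Hypotheses (b_gt0 : 0 < b) (c_gt0 : 0 < c) (k_le : k <= c * b).

Definition chunk (m : message k) (j : nat) : message b :=
  [tuple nth false m (j * b + i) | i < b].

(** [h] lists the inboxes of successive short rounds. Chunk 0 alone decides between a message and
    [None], as the chunks of a message arrive all or none. *)
Definition join_chunks (h : seq (ident l -> option (message b)))
    (i : ident l) : option (message k) :=
  let part j := nth (fun=> None) h j i in
  omap (fun _ : message b =>
    [tuple nth false (if part (x %/ b) is Some m then m : seq bool else [::])
       (x %% b) | x < k]) (part 0).

Lemma join_chunksK (f : ident l -> option (message k)) :
  join_chunks (mkseq (fun j i => omap (chunk^~ j) (f i)) c) = f.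
Proof.
apply: boolp.funext => i; rewrite /join_chunks nth_mkseq //.
case fi: (f i) => [m|] //=; congr Some; apply: eq_from_tnth => x.
have lt_xc : x %/ b < c by rewrite ltn_divLR // (leq_trans _ k_le).
rewrite tnth_mktuple nth_mkseq // fi /=.
rewrite -[x %% b]/(val (Ordinal (ltn_pmod x b_gt0))).
by rewrite nth_mktuple /= -divn_eq (tnth_nth false).
Qed.

Variable A : algorithm l k.

(** The inboxes of the current batch are stored; their number is also the index of the next chunk to
    send. The [c]-th inbox triggers one round of [A]. *)
Definition chunked_receive
    (s : state A * seq (ident l -> option (message b))) inb :=
  let h := rcons s.2 inb in
  if size h == c then (receive s.1 (join_chunks h), [::]) else (s.1, h).

Definition chunked : algorithm l b :=
  @Algorithm l b (state A * seq (ident l -> option (message b)))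
    (fun i E => (start A i E, [::]))
    (fun s w => omap (chunk^~ (size s.2)) (send s.1 w))
    chunked_receive
    (fun s => output s.1).

Variables (V : finType) (id_of : V -> ident l).

Lemma iter_chunked_round (conf : V -> state A) (j : nat) : j < c ->
  iter j (@round l b chunked V id_of) (fun v => (conf v, [::])) =
  fun v => (conf v,
    mkseq (fun t i => omap (chunk^~ t) (@inbox l k A V id_of conf v i)) j).
Proof.
elim: j => [|j IHj] lt_jc //; rewrite iterS IHj ?(ltnW lt_jc) //.
apply: boolp.funext => v; rewrite /round /= /chunked_receive /=.
rewrite size_rcons size_mkseq ltn_eqF //; congr pair.
rewrite mkseqS; congr rcons.
apply: boolp.funext => i; rewrite /inbox /=.
by case: pickP => //= u _; rewrite size_mkseq.
Qed.

Lemma chunked_roundE (conf : V -> state A) :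
  iter c (@round l b chunked V id_of) (fun v => (conf v, [::])) =
  fun v => (@round l k A V id_of conf v, [::]).
Proof.
rewrite -(prednK c_gt0) iterS iter_chunked_round ?prednK //.
apply: boolp.funext => v; rewrite /round /= /chunked_receive /=.
rewrite size_rcons size_mkseq prednK // eqxx; congr (receive _ _, _).
rewrite -[RHS]join_chunksK; congr join_chunks.
rewrite -[in RHS](prednK c_gt0) mkseqS; congr rcons.
apply: boolp.funext => i; rewrite /inbox /=.
by case: pickP => //= u _; rewrite size_mkseq.
Qed.

Lemma run_chunked (H : hypergraph V) T :
  run chunked H id_of (T * c) = fun v => (run A H id_of T v, [::]).
Proof.
elim: T => [|T IHT] //.
by rewrite /run mulSn iterD -/(run chunked _ _ _) IHT chunked_roundE.
Qed.

End Chunks.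

(** A long round costs [k %/ b + 1] short ones, enough for [k] bits. *)
Lemma solves_chunked (r n l b k T : nat) (A : algorithm l k) : 0 < b ->
  solves_simplex_enumeration r n A T ->
  exists A' : algorithm l b,
    solves_simplex_enumeration r n A' (T * (k %/ b).+1).
Proof.
move=> b_gt0 solA; exists (chunked b (k %/ b).+1 A) => V H id_of nV rH injid.
have [S_ [S_enum outA]] := solA V H id_of nV rH injid.
exists S_; split=> // v.
by rewrite run_chunked //= ltnW // ltn_ceil.
Qed.

(** * Assignment of edges to relays and of simplices to workers *)

Lemma leq_expW m n e : m <= n -> m ^ e <= n ^ e.
Proof. by case: e => // e; rewrite leq_exp2r. Qed.

(** The pairs [(f x, g x)] are distinct for distinct [x]. [G] is a list because the groups of a
    simplex may repeat. *)
Lemma card_le_pairs (X : finType) (D : {set X}) (f g : X -> nat)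
    (G : seq nat) (m : nat) :
  {in D &, forall x y, f x = f y -> g x = g y -> x = y} ->
  {in D, forall x, (f x \in G) && (g x < m)} -> #|D| <= size G * m.
Proof.
move=> fg_inj fgD; rewrite cardE -(size_map (fun x => (f x, g x))).
rewrite -[m in _ * m](size_iota 0) -(size_allpairs pair); apply: uniq_leq_size.
  rewrite map_inj_in_uniq ?enum_uniq // => x y; rewrite !mem_enum => xD yD [].
  exact: fg_inj.
move=> _ /mapP[x + ->]; rewrite mem_enum => /fgD /andP[xG xm].
by rewrite allpairs_f // mem_iota.
Qed.

(** * Counting sets by constraints on their first two elements *)

Section SortedElements.
Variables (X : finType) (x0 : X).

(** A set is determined by its enumeration, a function on [r + 2] positions with values in [A] at 0,
    in [B] at 1 and in [W] elsewhere. *)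
Lemma card_le_sorted (r : nat) (D : {set {set X}}) (A B W : {set X}) :
  {in D, forall e : {set X}, [/\ #|e| = r.+2, nth x0 (enum e) 0 \in A,
     nth x0 (enum e) 1 \in B & e \subset W]} ->
  #|D| <= #|A| * #|B| * #|W| ^ r.
Proof.
move=> D_sorted.
pose F (i : 'I_r.+2) := match val i with 0 => A | 1 => B | _ => W end.
pose f (e : {set X}) := [ffun i : 'I_r.+2 => nth x0 (enum e) i].
have f_inj : {in D &, injective f}.
  move=> e e' /D_sorted[se _ _ _] /D_sorted[se' _ _ _] /ffunP ff'.
  have eq_enum : enum e = enum e'.
    apply: (@eq_from_nth _ x0); first by rewrite -!cardE se.
    move=> i; rewrite -cardE se => lt_i.
    by have := ff' (Ordinal lt_i); rewrite !ffunE.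
  by apply/setP => x; rewrite -mem_enum eq_enum mem_enum.
rewrite -(card_in_imset f_inj).
have sub_fam : f @: D \subset family F.
  apply/subsetP => _ /imsetP[e /D_sorted[se e0 e1 /subsetP eW] ->].
  apply/familyP => -[[|[|i]] lt_i]; rewrite ffunE //=.
  by apply: eW; rewrite -mem_enum mem_nth // -cardE se.
apply: leq_trans (subset_leq_card sub_fam) _.
rewrite card_family foldrE big_map big_enum /= !big_ord_recl /= mulnA.
by rewrite (eq_bigr (fun=> #|W|)) // big_const_ord iter_muln_1.
Qed.

End SortedElements.

Section Layout.
Variables (X : finType) (x0 : X) (q r : nat) (I : {set X}).

Definition rank (x : X) := index x (enum I).
Definition group (x : X) := rank x %% q.
Definition block (x : X) := rank x %/ q.

Definition owner (e : {set X}) : X := nth x0 (enum e) 1.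

(* [block] has about [r] base-[q] digits; the relay of [e] is addressed by the
   last [r] of them for the first element of [e] and one more for the second.
   Hence, once the groups are fixed, every relay carries about the same share
   of the edges, and knowing the relay determines the first element up to its
   group (and up to the factor [2 ^ r.+1] by which [#|I|] may exceed
   [q ^ r.+1]). The owner is the second element because the relay leaves it
   far less constrained than the first. *)
Definition relay (e : {set X}) : nat :=
  block (nth x0 (enum e) 0) %% q ^ r * q + block (nth x0 (enum e) 1) %% q.

(** The tuple of groups numbered below [q ^ r.+1]; writing [q] as [q.-1.+1] makes [inord]
    available. *)
Definition worker (S : {set X}) : nat :=
  enum_rank [tuple inord (group (nth x0 (enum S) i)) : 'I_q.-1.+1 | i < r.+1].

Definition to_relay (u w : X) : {set {set X}} :=
  [set e : {set X} | [&& e \subset I, #|e| == r, owner e == u &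
                         relay e == rank w]].

(** [S] ranges over all potential simplices, so both ends can compute this set from the IDs
    alone. *)
Definition to_worker (u w : X) : {set {set X}} :=
  [set e : {set X} | [&& #|e| == r, relay e == rank u &
     [exists S : {set X}, [&& S \subset I, #|S| == r.+1, worker S == rank w &
                              e \subset S]]]].

(** A factor [r + 1] per element for its group, [2 ^ r.+1] for each of the first two elements since
    [#|I|] may exceed [q ^ r.+1], and [2 ^ r] for rounding in [#|I| / q]. *)
Definition load_const := r.+1 ^ r * (2 ^ r.+1) ^ 2 * 2 ^ r.

Hypotheses (r_ge2 : 2 <= r) (q_gt0 : 0 < q).
Hypotheses (le_qI : q ^ r.+1 <= #|I|) (lt_Iq : #|I| < q.+1 ^ r.+1).

Lemma rank_inj : {in I &, injective rank}.
Proof.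
move=> x y xI yI eq_rank; rewrite -(@nth_index _ x0 x (enum I)) ?mem_enum //.
by rewrite -/(rank x) eq_rank nth_index ?mem_enum.
Qed.

Lemma rank_lt x : x \in I -> rank x < #|I|.
Proof. by move=> xI; rewrite cardE index_mem mem_enum. Qed.

Lemma rank_onto k : k < #|I| -> exists2 x, x \in I & rank x = k.
Proof.
move=> lt_k; exists (nth x0 (enum I) k).
  by rewrite -mem_enum mem_nth // -cardE.
by rewrite /rank index_uniq ?enum_uniq // -cardE.
Qed.

Lemma group_lt x : group x < q. Proof. by rewrite ltn_mod. Qed.

Lemma relay_lt e : relay e < #|I|.
Proof.
apply: leq_trans le_qI; rewrite expnSr /relay; set a := _ %% q ^ r.
have lt_a : a < q ^ r by rewrite ltn_mod expn_gt0 q_gt0.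
rewrite (@leq_trans (a.+1 * q)) ?leq_mul2r ?lt_a ?orbT //.
by rewrite mulSnr ltn_add2l ltn_mod.
Qed.

Lemma worker_lt S : worker S < #|I|.
Proof.
apply: leq_trans le_qI; apply: leq_trans (ltn_ord _) _.
by rewrite card_tuple card_ord prednK.
Qed.

(** Equal numbers mean equal tuples of groups, so a worker only ever deals with one list of [r + 1]
    groups. *)
Lemma worker_group (S S' : {set X}) x :
  #|S| = r.+1 -> #|S'| = r.+1 -> worker S = worker S' -> x \in S ->
  group x \in map group (enum S').
Proof.
move=> sS sS' /val_inj /enum_rank_inj eq_t xS.
have lt_x : index x (enum S) < r.+1 by rewrite -sS cardE index_mem mem_enum.
have := congr1 (fun t => val (tnth t (Ordinal lt_x))) eq_t.
rewrite !tnth_mktuple /= nth_index ?mem_enum // !inordK ?prednK ?group_lt //.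
by move=> ->; rewrite map_f // mem_nth // -cardE sS'.
Qed.

Lemma relay_div e : relay e %/ q = block (nth x0 (enum e) 0) %% q ^ r.
Proof. by rewrite /relay divnMDl // divn_small ?addn0 // ltn_mod. Qed.

Lemma relay_mod e : relay e %% q = block (nth x0 (enum e) 1) %% q.
Proof. by rewrite /relay modnMDl modn_mod. Qed.

(** The rank is recovered from group and block, and the block from its quotient and remainder by
    [m]. *)
Lemma rank_split x y m : x \in I -> y \in I -> group x = group y ->
  block x %% m = block y %% m -> block x %/ m = block y %/ m -> x = y.
Proof.
move=> xI yI eq_g eq_m eq_d; apply: rank_inj => //.
rewrite (divn_eq (rank x) q) (divn_eq (rank y) q).
rewrite -!/(group _) -!/(block _) eq_g.
by rewrite (divn_eq (block x) m) (divn_eq (block y) m) eq_m eq_d.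
Qed.

(** * Bounds on the number of bits between two vertices *)

Lemma card_lt_const : #|I| < 2 ^ r.+1 * q ^ r.+1.
Proof.
apply: leq_trans lt_Iq _; rewrite -expnMn leq_exp2r // mul2n -addnn.
by rewrite -add1n leq_add2r.
Qed.

Lemma block_div_lt x : x \in I -> block x %/ q ^ r < 2 ^ r.+1.
Proof.
move=> xI; rewrite /block -divnMA -expnS ltn_divLR ?expn_gt0 ?q_gt0 //.
exact: ltn_trans (rank_lt xI) card_lt_const.
Qed.

(** The owner fixes the second element. The relay fixes the block of the first modulo [q ^ r],
    leaving [q] groups and at most [2 ^ r.+1] quotients. The other [r - 2] elements are free. *)
Lemma card_to_relay u w :
  #|to_relay u w| <= q * 2 ^ r.+1 * #|I| ^ (r - 2).
Proof.
pose A := [set x in I | block x %% q ^ r == rank w %/ q].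
have cardA : #|A| <= q * 2 ^ r.+1.
  rewrite -[q in q * _](size_iota 0).
  apply: (@card_le_pairs _ A group (fun x => block x %/ q ^ r)).
    move=> x y /setIdP[xI /eqP xw] /setIdP[yI /eqP yw] eq_g eq_d.
    by apply: (@rank_split x y (q ^ r)); rewrite // xw yw.
  by move=> x /setIdP[xI _]; rewrite mem_iota add0n group_lt block_div_lt.
have def_r : (r - 2).+2 = r by rewrite -addn2 subnK.
apply: (@leq_trans (#|A| * #|[set u]| * #|I| ^ (r - 2))).
  apply: (@card_le_sorted _ x0) => e.
  rewrite [e \in _]inE => /and4P[eI /eqP re /eqP own_e /eqP relay_e].
  rewrite def_r; split=> //; last by rewrite inE -own_e.
  rewrite inE -relay_div relay_e eqxx andbT (subsetP eI) //.
  rewrite -mem_enum mem_nth //.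
  by rewrite -cardE re ltnW.
by rewrite cards1 muln1 leq_mul2r cardA orbT.
Qed.

(** The worker confines all elements to [r + 1] groups. Within them, the relay fixes the block of
    the first element modulo [q ^ r] and of the second modulo [q]. *)
Lemma card_to_worker u w :
  #|to_worker u w| <= r.+1 * 2 ^ r.+1 * (r.+1 * (2 ^ r.+1 * q ^ r.-1)) *
                      (r.+1 * (#|I| %/ q).+1) ^ (r - 2).
Proof.
have [-> | [e1 ]] := set_0Vmem (to_worker u w); first by rewrite cards0.
rewrite inE => /and3P[_ _ /existsP[S1 /and4P[_ /eqP sS1 /eqP wS1 _]]].
(* Any one set assigned to [w] reveals the groups of all of them. *)
pose G := map group (enum S1).
have sG : size G = r.+1 by rewrite size_map -cardE.
pose W := [set x in I | group x \in G].
have cardW : #|W| <= r.+1 * (#|I| %/ q).+1.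
  rewrite -{1}sG; apply: (@card_le_pairs _ W group block).
    move=> x y /setIdP[xI _] /setIdP[yI _] eq_g eq_b.
    by apply: (@rank_split x y 1); rewrite // eq_b.
  by move=> x /setIdP[xI ->]; rewrite ltnS leq_div2r // ltnW // rank_lt.
pose A := [set x in W | block x %% q ^ r == rank u %/ q].
have cardA : #|A| <= r.+1 * 2 ^ r.+1.
  rewrite -{1}sG.
  apply: (@card_le_pairs _ A group (fun x => block x %/ q ^ r)).
    move=> x y /setIdP[/setIdP[xI _] /eqP xw] /setIdP[/setIdP[yI _] /eqP yw].
    by move=> eq_g eq_d; apply: (@rank_split x y (q ^ r)); rewrite // xw yw.
  by move=> x /setIdP[/setIdP[xI ->] _]; rewrite block_div_lt.
pose B := [set x in W | block x %% q == rank u %% q].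
have cardB : #|B| <= r.+1 * (2 ^ r.+1 * q ^ r.-1).
  rewrite -{1}sG; apply: (@card_le_pairs _ B group (fun x => block x %/ q)).
    move=> x y /setIdP[/setIdP[xI _] /eqP xw] /setIdP[/setIdP[yI _] /eqP yw].
    by move=> eq_g eq_d; apply: (@rank_split x y q); rewrite // xw yw.
  move=> x /setIdP[/setIdP[xI ->] _] /=.
  (* The quotient is the rank divided by [q ^ 2], which leaves [q ^ r.-1] out of [q ^ r.+1]. *)
  rewrite -divnMA ltn_divLR ?muln_gt0 ?q_gt0 // -mulnA.
  rewrite mulnn -expnD addn2 prednK ?(ltnW r_ge2) //.
  exact: ltn_trans (rank_lt xI) card_lt_const.
have def_r : (r - 2).+2 = r by rewrite -addn2 subnK.
apply: (@leq_trans (#|A| * #|B| * #|W| ^ (r - 2))); last first.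
  by rewrite !leq_mul // leq_expW.
apply: (@card_le_sorted _ x0) => e.
rewrite [e \in _]inE => /and3P[/eqP re /eqP relay_e /existsP[S]].
case/and4P=> /subsetP SI /eqP sS /eqP wS /subsetP eS.
have eW : e \subset W.
  apply/subsetP => x xe; rewrite inE SI ?eS //=.
  by apply: (@worker_group S); rewrite ?wS ?eS.
have e_nth i : i < 2 -> nth x0 (enum e) i \in W.
  move=> lt_i; rewrite (subsetP eW) // -mem_enum mem_nth // -cardE re.
  exact: leq_trans r_ge2.
rewrite def_r; split=> //.
  by rewrite inE e_nth // -relay_div relay_e eqxx.
by rewrite inE e_nth // -relay_mod relay_e eqxx.
Qed.

Lemma to_relay_load u w :
  #|to_relay u w| <= load_const * (q * #|I| ^ (r - 2)).
Proof.
apply: leq_trans (card_to_relay u w) _.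
rewrite [q * _]mulnC -mulnA leq_mul2r; apply/orP; right.
rewrite /load_const [_ * (_ ^ 2)]mulnC -mulnA -mulnn -mulnA leq_pmulr //.
by rewrite !muln_gt0 !expn_gt0.
Qed.

Lemma to_worker_load u w :
  #|to_worker u w| <= load_const * (q * #|I| ^ (r - 2)).
Proof.
apply: leq_trans (card_to_worker u w) _.
have [s def_r] : exists s, r = s.+2 by exists r.-2; case: r r_ge2 => [|[]].
have le_q : q <= #|I|.
  by apply: leq_trans le_qI; rewrite -[q in q <= _]expn1 leq_pexp2l.
have le_blk : (#|I| %/ q).+1 * q <= 2 * #|I|.
  by rewrite mulSn mul2n -addnn leq_add // leq_divM.
have: ((#|I| %/ q).+1 * q) ^ s <= (2 * #|I|) ^ s.
  by rewrite leq_expW.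
rewrite /load_const; move: (2 ^ r.+1) => c; rewrite def_r subSS subSS subn0 /=.
move=> le_s.
(* Of the [s + 1] factors [q], one stays; the other [s] cancel the division by [q] in the [s] free
   choices. *)
rewrite (_ : _ * _ = s.+3 ^ s.+2 * c ^ 2 * (q * ((#|I| %/ q).+1 * q) ^ s)).
  rewrite -[leqRHS]mulnA leq_mul2l; apply/orP; right.
  rewrite mulnCA leq_mul2l; apply/orP; right.
  apply: leq_trans le_s _; rewrite expnMn leq_mul2r; apply/orP; right.
  by rewrite leq_exp2l // ltnW // ltnW.
rewrite !expnMn !expnS.
ring.
Qed.

End Layout.

(** * The three-round algorithm with long messages *)

Section BitVectors.
Variables (X : finType) (x0 : X) (k : nat).
Implicit Types (L D : {set X}).

Definition encode L D : message k :=
  [tuple nth false [seq x \in D | x <- enum L] i | i < k].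

Definition decode L (m : message k) : {set X} :=
  [set x in L | nth false m (index x (enum L))].

Lemma encodeK L D : #|L| <= k -> decode L (encode L D) = L :&: D.
Proof.
move=> le_Lk; apply/setP => x; rewrite !inE; case xL: (x \in L) => //=.
have lt_xL : index x (enum L) < size (enum L) by rewrite index_mem mem_enum.
have lt_xk : index x (enum L) < k by rewrite (leq_trans lt_xL) // -cardE.
rewrite -[index x _]/(val (Ordinal lt_xk)) nth_mktuple /=.
by rewrite (nth_map x0) // nth_index // mem_enum.
Qed.

End BitVectors.

Section Protocol.
Variables (l q r k : nat).

Let x0 : ident l := nseq_tuple l false.

Record node := Node {
  phase : nat;
  own : ident l;
  ids : {set ident l};
  known : {set {set ident l}}
}.

(* Phase 0 only announces the IDs, phase 1 is owner to relay, phase 2 is relay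
   to worker. *)
Definition link (s : node) (u w : ident l) : {set {set ident l}} :=
  if phase s == 1 then to_relay x0 q r (ids s) u w
  else to_worker x0 q r (ids s) u w.

Definition node_send (s : node) (w : ident l) : option (message k) :=
  if phase s == 0 then Some (nseq_tuple k false)
  else Some (encode k (link s (own s) w) (known s)).

(** In phase 0 the mere arrival of a message reveals an ID; the own ID is added since no vertex
    writes to itself. *)
Definition node_receive (s : node) (inb : ident l -> option (message k)) :=
  if phase s == 0
  then Node 1 (own s) (own s |: [set i | inb i != None]) (known s)
  else Node (phase s).+1 (own s) (ids s)
         (known s :|: [set e | [exists i,
            if inb i is Some m then e \in decode (link s i (own s)) m
            else false]]).

Definition node_output (s : node) : {set {set ident l}} :=
  [set S : {set ident l} | [&& S \subset ids s, #|S| == r.+1,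
     worker x0 q r (ids s) S == rank (ids s) (own s) &
     [forall e : {set ident l},
        (e \subset S) && (#|e| == r) ==> (e \in known s)]]].

Definition simplex_algorithm : algorithm l k :=
  @Algorithm l k node (fun i E => Node 0 i set0 E)
    node_send node_receive node_output.

Notation A := simplex_algorithm.

(** * Correctness of the three rounds *)

Variables (V : finType) (H : hypergraph V) (id_of : V -> ident l).
Hypotheses (rH : uniform H r) (id_inj : injective id_of).
Hypotheses (r_ge2 : 2 <= r) (q_gt0 : 0 < q).
Hypotheses (le_qV : q ^ r.+1 <= #|V|) (lt_Vq : #|V| < q.+1 ^ r.+1).
Hypothesis load_le_k : load_const r * (q * #|V| ^ (r - 2)) <= k.

Let I := id_of @: [set: V].
Let E := [set id_of @: e | e : {set V} in edges H].

Let cardI : #|I| = #|V|. Proof. by rewrite card_imset // cardsT. Qed.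
Let le_qI : q ^ r.+1 <= #|I|. Proof. by rewrite cardI. Qed.
Let lt_Iq : #|I| < q.+1 ^ r.+1. Proof. by rewrite cardI. Qed.
Let idI v : id_of v \in I. Proof. by rewrite imset_f. Qed.

Let idsP i : i \in I -> exists v, i = id_of v.
Proof. by case/imsetP => v _ ->; exists v. Qed.

Lemma inbox_id (conf : V -> state A) v u : u != v ->
  @inbox l k A V id_of conf v (id_of u) = node_send (conf u) (id_of v).
Proof.
move=> uv; rewrite /inbox; case: pickP => [u' /andP[_ /eqP /id_inj ->] //|].
by move=> /(_ u); rewrite uv eqxx.
Qed.

Lemma inbox_None (conf : V -> state A) v i :
  (forall u, u != v -> i != id_of u) -> @inbox l k A V id_of conf v i = None.
Proof.
move=> no_i; rewrite /inbox; case: pickP => // u /andP[/no_i + /eqP ui].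
by rewrite ui eqxx.
Qed.

Lemma run1 v :
  run A H id_of 1 v = Node 1 (id_of v) I
    [set id_of @: e | e : {set V} in incident_edges H v].
Proof.
rewrite /run /= /round /= /node_receive /=; congr Node.
apply/setP => i; rewrite !inE; have [-> | iv /=] := eqVneq i (id_of v).
  by rewrite idI.
have [/idsP[u def_i] | nIi] := boolP (i \in I).
  by rewrite def_i inbox_id //; apply: contraNneq iv => uv; rewrite def_i uv.
rewrite inbox_None // => u _; apply: contraNneq nIi => ->.
by [].
Qed.

(** Equal phases and ID sets give sender and receiver the same [link], which fits into [k] bits, so
    decoding recovers its known edges exactly. Staying inside [E] gives soundness, the last
    inclusion completeness. *)
Lemma exchange (p : nat) (conf : V -> state A)
    (D : V -> {set {set ident l}}) :
  (forall v, conf v = Node p.+1 (id_of v) I (D v)) ->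
  (forall v, D v \subset E) ->
  exists D' : V -> {set {set ident l}},
    [/\ forall v, @round l k A V id_of conf v = Node p.+2 (id_of v) I (D' v),
        forall v, D' v \subset E
      & forall u v, link (conf u) (id_of u) (id_of v) :&: D u \subset D' v].
Proof.
move=> conf_D DE.
have link_conf u v : link (conf u) = link (conf v) by rewrite !conf_D.
have link_le v i j : #|link (conf v) i j| <= k.
  apply: leq_trans load_le_k; rewrite conf_D /link /= -cardI.
  by case: eqP => _; [apply: to_relay_load | apply: to_worker_load].
pose D' v := known (@round l k A V id_of conf v).
have D'E v : D' v = D v :|: [set e | [exists i,
    if @inbox l k A V id_of conf v i is Some m
    then e \in decode (link (conf v) i (id_of v)) m else false]].
  by rewrite /D' /round /= /node_receive {1}conf_D /= {1 3}conf_D.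
have node_sendE u v : node_send (conf u) (id_of v) =
    Some (encode k (link (conf u) (id_of u) (id_of v)) (D u)).
  by rewrite /node_send conf_D.
exists D'; split.
- by move=> v; rewrite /D' /round /= /node_receive conf_D.
- move=> v; rewrite D'E subUset DE; apply/subsetP => e.
  rewrite inE => /existsP[i]; rewrite /inbox.
  case: pickP => // u /andP[_ /eqP <-] /=; rewrite node_sendE (link_conf v u).
  by rewrite (encodeK set0) // => /setIP[_]; apply: (subsetP (DE u)).
- move=> u v; apply/subsetP => e e_uv; rewrite D'E inE.
  (* No message goes from a vertex to itself, but then [e] is already known. *)
  have [uv_eq | uv] := eqVneq u v.
    by case/setIP: e_uv; rewrite uv_eq => _ ->.
  apply/orP; right; rewrite inE; apply/existsP; exists (id_of u).
  by rewrite inbox_id // node_sendE (link_conf v u) (encodeK set0).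
Qed.

Lemma id_imset_subset (e S : {set V}) :
  (id_of @: e \subset id_of @: S) = (e \subset S).
Proof.
apply/idP/idP => [/subsetP sub | /imsetS]; last exact.
by apply/subsetP => x xe; have := sub _ (imset_f id_of xe); rewrite mem_imset.
Qed.

Lemma id_preim (S : {set ident l}) : S \subset I ->
  exists S' : {set V}, S = id_of @: S'.
Proof.
move=> /subsetP SI; exists (id_of @^-1: S); apply/setP => i.
apply/idP/imsetP => [iS | [v]]; last by rewrite inE => vS ->.
by have [v def_i] := idsP (SI i iS); exists v; rewrite // inE -def_i.
Qed.

Lemma edge_card e : e \in E -> #|e| = r /\ e \subset I.
Proof.
move=> /imsetP[e' e'H ->]; rewrite card_imset // (rH e'H); split=> //.
by rewrite imsetS // subsetT.
Qed.

(** An edge is followed from its owner [u], who knows it as incident, through its relay [y] to the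
    worker [v]. *)
Lemma run3 v : exists D : {set {set ident l}},
  [/\ run A H id_of 3 v = Node 3 (id_of v) I D, D \subset E
    & forall S e : {set ident l}, S \subset I -> #|S| = r.+1 ->
        worker x0 q r I S = rank I (id_of v) -> e \subset S ->
        e \in E -> e \in D].
Proof.
pose D1 v := [set id_of @: e | e : {set V} in incident_edges H v].
have D1E u : D1 u \subset E.
  apply: imsetS; apply/subsetP => e.
  by rewrite inE => /andP[].
have [D2 [run2 D2E D12]] := exchange run1 D1E.
have [D3 [run3 D3E D23]] := exchange run2 D2E.
exists (D3 v); split; [exact: run3 | exact: D3E | move=> S e SI sS wS eS eE].
have [re eI] := edge_card eE.
have node k' : k' < #|I| -> exists u, rank I (id_of u) = k'.
  by case/(rank_onto x0) => i /idsP[u ->] <-; exists u.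
have [y rank_y] := node _ (relay_lt x0 q_gt0 le_qI e).
have ownI : owner x0 e \in e.
  by rewrite -mem_enum mem_nth // -cardE re.
have [u def_u] := idsP (subsetP eI _ ownI).
have e1 : e \in D1 u.
  move: ownI; rewrite def_u; case/imsetP: eE => e' e'H ->.
  rewrite mem_imset // => ue'.
  by rewrite imset_f // inE e'H.
have e2 : e \in D2 y.
  apply: (subsetP (D12 u y)); rewrite inE e1 andbT run1 inE eI re eqxx def_u.
  by rewrite rank_y !eqxx.
apply: (subsetP (D23 y v)); rewrite inE e2 andbT run2 inE re eqxx rank_y.
rewrite eqxx /=.
by apply/existsP; exists S; rewrite SI sS wS !eqxx.
Qed.

Lemma simplex_algorithm_correct : exists S_ : V -> {set {set V}},
  enumerates_simplices H r S_ /\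
  forall v, output (run A H id_of 3 v) =
            [set id_of @: S | S : {set V} in S_ v].
Proof.
pose w (S : {set V}) := worker x0 q r I (id_of @: S).
(* Ranks biject the IDs with the numbers below [#|I|], so each simplex has exactly one worker. *)
exists (fun v => [set S in simplices H r | w S == rank I (id_of v)]).
split; first split.
- move=> u v; apply: contraNT => /pred0Pn[S /=].
  rewrite !inE => /andP[/andP[_ /eqP ->] /andP[_ /eqP]].
  by move/(rank_inj x0) => /(_ (idI _) (idI _)) /id_inj ->.
- apply/setP => S; apply/bigcupP/idP => [[v _ /setIdP[] //] | S_simplex].
  have [i /idsP[v ->] rank_v] :=
    rank_onto x0 (worker_lt x0 q_gt0 le_qI (id_of @: S)).
  by exists v; rewrite // inE S_simplex rank_v /=.
move=> v; have [D [-> DE ED]] := run3 v.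
apply/setP => S; apply/idP/imsetP => /=.
  rewrite inE /= => /and4P[SI /eqP sS /eqP wS /forallP SD].
  have [S' def_S] := id_preim SI; exists S' => //; subst S.
  rewrite inE /w wS eqxx andbT inE; move: sS; rewrite card_imset // => ->.
  rewrite eqxx; apply/forallP => e; apply/implyP => /andP[eS /eqP re].
  have /implyP := SD (id_of @: e).
  rewrite id_imset_subset eS card_imset // re eqxx => /(_ isT) /(subsetP DE).
  by rewrite mem_imset //; apply: imset_inj.
move=> [S' /setIdP[]]; rewrite inE => /andP[/eqP sS' /forallP S'E] /eqP wS' ->.
have SI : id_of @: S' \subset I by rewrite imsetS // subsetT.
rewrite inE /= SI card_imset // sS' eqxx -/(w _) wS' eqxx /=.
apply/forallP => e; apply/implyP => /andP[eS /eqP re].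
apply: (ED (id_of @: S')); rewrite ?card_imset //.
have [e' def_e] := id_preim (subset_trans eS SI); subst e.
apply/imsetP; exists e' => //; apply: (implyP (S'E e')).
by move: eS re; rewrite id_imset_subset card_imset // => -> ->; rewrite eqxx.
Qed.

End Protocol.

Lemma solves_simplex_algorithm l q r n : 2 <= r -> 0 < q ->
  q ^ r.+1 <= n -> n < q.+1 ^ r.+1 ->
  solves_simplex_enumeration r n
    (simplex_algorithm l q r (load_const r * (q * n ^ (r - 2)))) 3.
Proof.
move=> r_ge2 q_gt0 le_qn lt_nq V H id_of cardV rH id_inj; subst n.
exact: simplex_algorithm_correct.
Qed.

(** * Asymptotics *)

From mathcomp Require Import all_boot all_order all_algebra.
From mathcomp Require Import all_classical all_reals all_analysis.
Import Order.TTheory GRing.Theory Num.Theory.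
Import numFieldNormedType.Exports.
Local Open Scope classical_set_scope.
Local Open Scope ring_scope.

(** The integer root grows by at most one from [n] to [n + 1]. *)
Lemma nat_root_exists (m : nat) : exists q : nat -> nat,
  forall n, (q n ^ m.+1 <= n < (q n).+1 ^ m.+1)%N.
Proof.
suff q_ex n : exists q, (q ^ m.+1 <= n < q.+1 ^ m.+1)%N.
  by exists (fun n => xchoose (q_ex n)) => n; exact: xchooseP (q_ex n).
elim: n => [|n [q /andP[le_qn lt_nq]]].
  by exists 0%N; rewrite exp0n ?exp1n.
have [le_n|lt_n] := leqP (q.+1 ^ m.+1) n.+1; last first.
  by exists q; rewrite lt_n (leq_trans le_qn).
by exists q.+1; rewrite le_n (leq_ltn_trans lt_nq) // ltn_exp2r.
Qed.

Section Rates.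
Variable R : realType.

Lemma natr_root_le (q m n : nat) : (q ^ m.+1 <= n)%N ->
  q%:R <= n%:R `^ m.+1%:R^-1 :> R.
Proof.
move=> le_qn.
have -> : q%:R = (q ^ m.+1)%:R `^ m.+1%:R^-1 :> R.
  by rewrite natrX -powR_mulrn // -powRrM mulfV ?pnatr_eq0 // powRr1.
by rewrite ge0_ler_powR ?nnegrE ?invr_ge0 ?ler_nat.
Qed.

(** With [p] the root, [ln n = (m + 1) ln p] and [ln p < p]. This later absorbs the extra round
    caused by rounding. *)
Lemma ln_le_root (m n : nat) : (0 < n)%N ->
  ln n%:R <= m.+1%:R * n%:R `^ m.+1%:R^-1 :> R.
Proof.
move=> n_gt0; have p_gt0 : 0 < n%:R `^ m.+1%:R^-1 :> R.
  by rewrite powR_gt0 // ltr0n.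
have := ltW (ln_sublinear p_gt0).
by rewrite ln_powR mulrC ler_pdivrMr ?ltr0n // mulrC.
Qed.

Lemma powR_split_root (r n : nat) : (2 <= r)%N -> (0 < n)%N ->
  n%:R `^ (r%:R - 2 + r.+1%:R^-1) = n%:R ^+ (r - 2) * n%:R `^ r.+1%:R^-1 :> R.
Proof.
move=> r_ge2 n_gt0; rewrite -natrB // powRD ?powR_mulrn //.
by rewrite pnatr_eq0 -lt0n n_gt0 implybT.
Qed.

Lemma rounds_bigO (r c : nat) (B q : nat -> nat) : (2 <= r)%N ->
  (fun n => ln n%:R : R^o) =O_\oo (fun n => (B n)%:R : R^o) ->
  (forall n, q n ^ r.+1 <= n)%N ->
  (fun n => (3 * ((c * (q n * n ^ (r - 2))) %/ B n).+1)%:R : R^o) =O_\oo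
    (fun n => n%:R `^ (r%:R - 2 + r.+1%:R^-1) / ln n%:R : R^o).
Proof.
move=> r_ge2 /eqO_exP[k k_gt0 lnB] le_qn; apply/eqO_exP.
(* [c * k] bounds the quotient by [B n], where [ln n <= k * B n]; [r + 1] pays for the successor,
   through [ln_le_root]. *)
exists (3 * (c%:R * k + r.+1%:R)).
  by rewrite mulr_gt0 // ltr_wpDl ?mulr_ge0 ?ltr0n // ltW.
near=> n.
have n_ge2 : (2 <= n)%N by near: n; exact: nbhs_infty_ge.
have n_gt0 : (0 < n)%N by apply: leq_trans n_ge2.
have ln_gt0 : 0 < ln n%:R :> R by rewrite ln_gt0 // ltr1n.
have le_lnB : ln n%:R <= k * (B n)%:R :> R.
  rewrite -[leLHS]ger0_norm ?(ltW ln_gt0) // -[(B n)%:R]ger0_norm //.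
  by near: n.
have B_gt0 : 0 < (B n)%:R :> R.
  by rewrite -(pmulr_rgt0 _ k_gt0) (lt_le_trans ln_gt0).
rewrite powR_split_root //.
have n_ge1 : 1 <= n%:R ^+ (r - 2) :> R by rewrite exprn_ege1 // ler1n.
have le_q := natr_root_le (le_qn n).
have le_ln := ln_le_root r n_gt0.
move: le_q le_ln; set p : R := n%:R `^ _; set N : R := n%:R ^+ _ => le_q le_ln.
have p_ge0 : 0 <= p by apply: powR_ge0.
have N_ge0 : 0 <= N by apply: le_trans n_ge1.
rewrite ger0_norm ?ler0n // ger0_norm ?divr_ge0 ?mulr_ge0 ?(ltW ln_gt0) //.
rewrite natrM -mulrA ler_wpM2l ?ler0n // -natr1.
rewrite mulrDl lerD //; last first.
  rewrite mulrA ler_pdivlMr // mul1r (le_trans le_ln) // ler_wpM2l ?ler0n //.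
  by rewrite ler_peMl.
set K := (c * _)%N.
have le_K : K%:R <= c%:R * (N * p).
  by rewrite /K !natrM natrX mulrA -!mulrA ler_wpM2l ?ler0n // mulrC ler_wpM2l.
have le_div : (K %/ B n)%:R <= K%:R / (B n)%:R :> R.
  by rewrite ler_pdivlMr // -natrM ler_nat leq_divM.
apply: (le_trans le_div); rewrite ler_pdivrMr //.
apply: (le_trans le_K).
have -> : c%:R * k * (N * p / ln n%:R) * (B n)%:R =
    c%:R * (N * p) * (k * (B n)%:R / ln n%:R) by ring.
by rewrite ler_peMr ?mulr_ge0 // ler_pdivlMr // mul1r.
Unshelve. all: by end_near. Qed.

End Rates.

Theorem theorem9 (R : realType) (r : nat) (r_ge2 : (2 <= r)%N)
    (B L : nat -> nat)
    (B_log : (fun n => (B n)%:R : R^o) =Theta_\oo (fun n => ln n%:R : R^o))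
    (L_log : (fun n => (L n)%:R : R^o) =O_\oo (fun n => ln n%:R : R^o)) :
  exists T : nat -> nat,
    (fun n => (T n)%:R : R^o) =O_\oo
      (fun n => n%:R `^ (r%:R - 2 + r.+1%:R^-1) / ln n%:R : R^o) /\
    \forall n \near \oo, exists A : algorithm (L n) (B n),
      solves_simplex_enumeration r n A (T n).
Proof.
move: B_log; rewrite eqThetaE bigThetaE eqOmegaO => -[_ lnB].
have [q q_root] := nat_root_exists r.
exists (fun n => 3 * ((load_const r * (q n * n ^ (r - 2))) %/ B n).+1)%N.
split.
  by apply: rounds_bigO => // n; case/andP: (q_root n).
have /eqO_exP[k k_gt0 le_lnB] := lnB.
near=> n.
have n_ge2 : (2 <= n)%N by near: n; exact: nbhs_infty_ge.
have /andP[le_qn lt_nq] := q_root n.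
(* A zero root would force [n < 1]. *)
have q_gt0 : (0 < q n)%N.
  by rewrite lt0n; apply: contraTneq lt_nq => ->; rewrite exp1n -leqNgt ltnW.
(* Empty messages would force [ln n <= 0], impossible for [n >= 2]. *)
have B_gt0 : (0 < B n)%N.
  have : `|ln n%:R : R^o| <= k * `|(B n)%:R : R^o| by near: n.
  rewrite lt0n; apply: contraTneq => ->; rewrite normr0 mulr0 -ltNge normr_gt0.
  by rewrite gt_eqF // ln_gt0 // ltr1n.
exact: solves_chunked B_gt0
  (@solves_simplex_algorithm (L n) _ _ _ r_ge2 q_gt0 le_qn lt_nq).
Unshelve. all: by end_near. Qed.
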